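(* Let $X$ be a Banach space (over $\mathbb{R}$ or $\mathbb{C}$), let $Y\subseteq X$ be a Banach space with norm $\|\cdot\|_Y$ that is compactly embedded into $X$, and let $(a_n)_{n\in\mathbb{N}}$ be a weakly null sequence of functionals in $X^*$, meaning that $\lim_{n\to\infty}a_n(x)=0$ for every $x\in X$. Then there exists a sequence $(\varepsilon_n)_{n\in\mathbb{N}}$ of nonnegative real numbers with $\varepsilon_n\searrow 0$ such that $|a_n(y)|\leq \varepsilon_n\|y\|_Y$ for every $n\in\mathbb{N}$ and every $y\in Y$.
   Context: $X^*$ is the space of continuous linear functionals on $X$. A Banach space $(Y,\|\cdot\|_Y)$ is compactly embedded into $X$ if $Y$ is a linear subspace of $X$ and the inclusion map $(Y,\|\cdot\|_Y)\to (X,\|\cdot\|_X)$ is a compact operator, i.e. the unit ball $\{y\in Y:\|y\|_Y\leq 1\}$ is relatively compact in $X$. The norm $\|\cdot\|_Y$ is in general not the restriction of $\|\cdot\|_X$. The notation $\varepsilon_n\searrow 0$ means that $(\varepsilon_n)$ is nonincreasing and converges to $0$. *)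

(* Defs.v *)
From HB Require Import structures.
From mathcomp Require Import all_boot all_order all_algebra.
From mathcomp Require Import complex.
From mathcomp Require Import all_classical all_reals all_analysis.

Set Implicit Arguments.
Unset Strict Implicit.
Unset Printing Implicit Defensive.

Import Order.TTheory GRing.Theory Num.Theory.
Import numFieldNormedType.Exports.

Local Open Scope classical_set_scope.
Local Open Scope ring_scope.

Inductive scalars := RealScalars | ComplexScalars.

Definition scalar_field (R : realType) (k : scalars) : numFieldType :=
  match k with
  | RealScalars => R
  | ComplexScalars => R[i]
  end.

(* Norms over [scalar_field R k] take their values in that field; this is the
   embedding of the real numbers needed to compare them with real bounds. *)
Definition of_real (R : realType) (k : scalars) : R -> scalar_field R k :=
  match k with
  | RealScalars => fun x => x
  | ComplexScalars => fun x => x%:C%C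
  end.

(* A linear subspace [S] of [X] that is a Banach space for a norm of its own:
   the inclusion [\val : Y -> X] is linear, but there is no relation between
   the norm of [Y] and that of [X]. *)
#[short(type="banachSubspaceType")]
HB.structure Definition BanachSubspace (K : numFieldType) (X : lmodType K)
    (S : pred X) :=
  { Y of CompleteNormedModule K Y & @GRing.SubLmodule K X S Y }.

Definition compact_operator (K : numFieldType) (Y X : normedModType K)
    (f : Y -> X) : Prop :=
  precompact (f @` [set y : Y | `|y| <= 1]).

Definition compactly_embedded (K : numFieldType) (X : normedModType K)
    (S : pred X) (Y : banachSubspaceType S) : Prop :=
  compact_operator (\val : Y -> X).

Definition weakly_null (K : numFieldType) (X : normedModType K)
    (a : nat -> X -> K) : Prop :=
  forall x : X, (fun n => a n x) @ \oo --> (0 : K).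

(* Main.v *)
Require Import Defs.
From HB Require Import structures.
From mathcomp Require Import all_boot all_order all_algebra.
From mathcomp Require Import complex.
From mathcomp Require Import all_classical all_reals all_analysis.

Set Implicit Arguments.
Unset Strict Implicit.
Unset Printing Implicit Defensive.

Import Order.TTheory GRing.Theory Num.Theory.
Import numFieldNormedType.Exports.

Local Open Scope classical_set_scope.
Local Open Scope ring_scope.

(** The functionals converge to zero at each point of the closure [C] in [X] of
    the unit ball of [Y], and [C] is compact. A pointwise convergent sequence of
    functions converges uniformly on a compact set as soon as it is
    equicontinuous, and equicontinuity of functionals is a common Lipschitz
    constant, which uniform boundedness provides: weak convergence makes every
    orbit [a n x] bounded, and [X] is complete
    ([uniform_boundedness], [cvg_unif_compact]). Hence the suprema of
    [`|a m y|] over the unit ball of [Y] tend to zero as [m] grows. They need not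
    be monotone in [m]; taking for [eps n] the supremum over all [m >= n] makes
    them so, and homogeneity extends the bound from the unit ball to [Y].

    Norms in [X] and [Y] are elements of the scalar field, which in the complex
    case is only partially ordered. The analysis below is done over a
    [numFieldType] that is archimedean for its norm, where norms can still be
    compared with one another and with natural numbers; real numbers enter
    through [of_real] when the suprema are taken. *)

Lemma of_real_le (R : realType) (k : scalars) (x y : R) :
  (of_real k x <= of_real k y) = (x <= y).
Proof. by case: k => //=; rewrite lecR. Qed.

Lemma of_real_lt (R : realType) (k : scalars) (x y : R) :
  (of_real k x < of_real k y) = (x < y).
Proof. by case: k => //=; rewrite ltcR. Qed.

Lemma of_real0 (R : realType) (k : scalars) : of_real k (0 : R) = 0.
Proof. by case: k. Qed.

Lemma normr_of_real (R : realType) (k : scalars) (x : scalar_field R k) :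
  exists r : R, of_real k r = `|x|.
Proof.
case: k x => [x|x]; first by exists `|x|.
by exists (Num.sqrt (complex.Re x ^+ 2 + complex.Im x ^+ 2)); case: x.
Qed.

Lemma of_real_natr (R : realType) (k : scalars) (n : nat) :
  of_real k (n%:R : R) = n%:R.
Proof. by case: k => //=; rewrite rmorph_nat. Qed.

Lemma scalar_field_archi (R : realType) (k : scalars) :
  Num.archimedean_axiom (scalar_field R k).
Proof.
move=> x; have [r <-] := normr_of_real x.
exists (Num.truncn r).+1; rewrite -of_real_natr of_real_lt.
exact: truncnS_gt.
Qed.

Lemma archi_inv_lt (K : numFieldType) (archiK : Num.archimedean_axiom K)
    (e : K) : 0 < e -> exists n : nat, n.+1%:R^-1 < e.
Proof.
move=> e0; have [n] := archiK e^-1; rewrite gtr0_norm ?invr_gt0// => en.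
exists n; rewrite -[e]invrK ltf_pV2 ?posrE ?invr_gt0//.
by rewrite (lt_le_trans en)// ler_nat.
Qed.

Section uniform_boundedness.
Variables (K : numFieldType) (archiK : Num.archimedean_axiom K).
Variables (I : Type) (X : completeNormedModType K).
Variable (a : I -> {linear X -> K^o}).
Hypothesis ca : forall i, continuous (a i).

(** By linearity, a bound near one point bounds the differences, hence the
    values near the origin, hence the operator norms. Every nonzero [z] is
    scaled to norm [r / 2], safely inside the ball. *)
Lemma bounded_on_ball_norm_le (x : X) (r M : K) : 0 < r ->
  (forall i y, `|x - y| < r -> `|a i y| <= M) ->
  forall i z, `|a i z| <= (M + M) / (r / 2) * `|z|.
Proof.
move=> r0 aM i z; have [->|z0] := eqVneq z 0.
  by rewrite linear0 !normr0 mulr0.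
have nz0 : 0 < `|z| by rewrite normr_gt0.
have t0 : 0 < r / 2 / `|z| by rewrite !divr_gt0.
have tz : `|(r / 2 / `|z|) *: z| < r.
  rewrite normrZ gtr0_norm// divfK ?gt_eqF// ltr_pdivrMr//.
  by rewrite ltr_pMr// ltr1n.
have : `|a i (x + (r / 2 / `|z|) *: z) - a i x| = r / 2 / `|z| * `|a i z|.
  by rewrite linearD addrC addKr linearZ normrZ gtr0_norm.
have := ler_normB (a i (x + (r / 2 / `|z|) *: z)) (a i x) => /[swap] ->.
have := aM i x; rewrite subrr normr0 => /(_ r0) ax.
have := aM i (x + (r / 2 / `|z|) *: z).
rewrite opprD addNKr normrN => /(_ tz) axz.
move=> /le_trans /(_ (lerD axz ax)); rewrite mulrC.
by rewrite -ler_pdivlMr// invf_div mulrA mulrAC.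
Qed.

(** A Baire category argument by nested balls: if the family is unbounded on
    every ball, each ball contains a smaller one on which some member exceeds
    any prescribed [N]; the centres form a Cauchy sequence and its limit lies in
    all the balls. Radii are inverses of positive integers: shrinking below two
    of them is then a [maxn], and the archimedean hypothesis sends them to
    zero. *)
Lemma exists_unbounded_orbit :
  (forall (x : X) (m N : nat),
    exists i y, `|x - y| < m.+1%:R^-1 /\ N%:R < `|a i y|) ->
  exists x, forall N : nat, exists i, N%:R < `|a i x|.
Proof.
move=> aB.
(* A pair [(x, m)] stands for the closed ball of centre [x] and radius
   [m.+1%:R^-1]; [P p q N] says that [q] is a valid successor of [p]. *)
pose P (p q : X * nat) N := (N <= q.2)%N /\
  forall z, `|q.1 - z| <= q.2.+1%:R^-1 ->
    `|p.1 - z| <= p.2.+1%:R^-1 /\ exists i, N%:R < `|a i z|.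
have step (p : nat * (X * nat)) : exists q, P p.2 q p.1.
  case: p => N [x m] /=; have [i [y [xy ay]]] := aB x m N.
  have : \forall z \near y, `|x - z| < m.+1%:R^-1 /\ N%:R < `|a i z|.
    apply: filterI; last first.
      exact: (@cvgr_norm_gt _ _ _ _ _ _ _ (@ca i y) _ ay).
    apply/nbhs_normP.
    exists (m.+1%:R^-1 - `|x - y|) => [|z /=]; first by rewrite /= subr_gt0.
    by rewrite ltrBrDl; apply: le_lt_trans; exact: ler_distD.
  move=> /nbhs_ballP[d /= d0 dB]; have [M Md] := archi_inv_lt archiK d0.
  exists (y, maxn M N); split=> /= [|z yz]; first exact: leq_maxr.
  have /dB[/ltW xz az] : ball y d z.
    rewrite -ball_normE /= (le_lt_trans yz)// (le_lt_trans _ Md)// lef_pV2 ?posrE//.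
    by rewrite ler_nat ltnS leq_maxl.
  by split=> //; exists i.
have [f fP] := choice step.
pose fix q n : X * nat := if n is p.+1 then f (p, q p) else (0, 0%N).
pose x n := (q n).1; pose r n : K := (q n).2.+1%:R^-1.
have qP n : P (q n) (q n.+1) n by exact: (fP (n, q n)).
have nested n k z : `|x (n + k)%N - z| <= r (n + k)%N -> `|x n - z| <= r n.
  elim: k z => [|k IHk] z; first by rewrite addn0.
  by rewrite addnS => /(qP _).2[/IHk].
have xball n k : (n <= k)%N -> `|x n - x k| <= r n.
  move=> nk; apply: (@nested n (k - n)%N); rewrite subnKC//.
  by rewrite subrr normr0 invr_ge0.
have : cvg (x @ \oo).
  apply: cauchy_cvg; apply: cauchy_exP => e e0; rewrite /fmapE -ball_normE.
  have [N Ne] := archi_inv_lt archiK e0.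
  exists (x N.+1), N.+1 => // n /= Nn.
  rewrite (le_lt_trans (xball _ _ Nn))// (le_lt_trans _ Ne)//.
  by rewrite lef_pV2 ?posrE// ler_nat ltnS (qP N).1.
move=> /cvg_ex[l xl]; exists l => N; have [_] := qP N; case/(_ l) => //.
(* The limit stays in the closed ball of rank [N.+1]: being strictly outside
   would persist for the terms close to it. *)
have := real_leNgt (normr_real (x N.+1 - l)) (_ : r N.+1 \is Num.real).
rewrite realV realn => -> //; apply/negP => rl.
have /cvgr_norm_gt/(_ _ rl)[M _ Mr] :
    (x N.+1 - x n) @[n --> \oo] --> x N.+1 - l.
  exact: cvgB (cvg_cst _) xl.
have := Mr (maxn M N.+1) (leq_maxl _ _).
by rewrite /= => /(le_lt_trans (xball _ _ (leq_maxr M N.+1))); rewrite ltxx.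
Qed.

(** Banach-Steinhaus: a pointwise bounded family cannot be unbounded on every
    ball, since the limit of the nested balls would have an unbounded orbit. *)
Lemma uniform_boundedness :
  (forall x, exists M, forall i, `|a i x| <= M) ->
  exists2 M, 0 < M & forall i x, `|a i x| <= M * `|x|.
Proof.
move=> bnd; apply: contrapT => nb.
have [|x ax] := exists_unbounded_orbit.
  move=> x m N; apply: contrapT => nx; apply: nb.
  (* [N.+1] instead of [N] keeps the constant positive. *)
  exists ((N.+1%:R + N.+1%:R) / (m.+1%:R^-1 / 2)); first by rewrite divr_gt0.
  apply: (@bounded_on_ball_norm_le x) => // i y xy.
  rewrite real_leNgt ?realn//; apply/negP => ay.
  by apply: nx; exists i, y; rewrite (lt_trans _ ay)// ltr_nat.
have [M aM] := bnd x; have [N MN] := archiK M; have [i Ni] := ax N.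
have M0 : 0 <= M by rewrite (le_trans _ (aM i)).
have := lt_le_trans Ni (aM i).
by rewrite -[M in _ < M]ger0_norm// => /lt_trans/(_ MN); rewrite ltxx.
Qed.

End uniform_boundedness.

Lemma compact_norm_lt (K : numFieldType) (archiK : Num.archimedean_axiom K)
    (X : normedModType K) (C : set X) :
  compact C -> exists N : nat, forall x, C x -> `|x| < N%:R.
Proof.
move=> /compact_near_coveringP cC.
have [|N _ CN] := cC _ \oo (fun n x => `|x| < n%:R) _; last first.
  by exists N => x; exact: (CN N (leqnn N)).
move=> x _; have [n] := archiK `|x|; rewrite normr_id => xn.
exists ([set z | `|z| < n%:R], [set m | (n <= m)%N]).
  split=> /=; last by exists n.
  by apply: cvgr_norm_lt xn; exact: cvg_id.
by move=> [z m] /= [zn nm]; rewrite (lt_le_trans zn)// ler_nat.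
Qed.

(** A common Lipschitz constant [M] spreads the bound [e / 2] at a point to the
    bound [e] on the ball of radius [e / 2 / M] around it; finitely many such
    balls cover [C]. *)
Lemma cvg_unif_compact (K : numFieldType) (X : normedModType K)
    (a : nat -> {linear X -> K^o}) (M : K) (C : set X) :
  0 < M -> (forall n x, `|a n x| <= M * `|x|) ->
  (forall x, C x -> (fun n => a n x) @ \oo --> (0 : K^o)) ->
  compact C -> forall e, 0 < e ->
  \forall n \near \oo, forall x, C x -> `|a n x| < e.
Proof.
move=> M0 aM a0 /compact_near_coveringP cC e e0.
apply: (cC _ _ (fun n x => `|a n x| < e)) => x Cx.
have e20 : 0 < e / 2 by rewrite divr_gt0.
exists ([set z | `|x - z| < e / 2 / M], [set n | `|a n x| < e / 2]).
  split=> /=; last exact: (cvgr0_norm_lt _ (a0 x Cx)).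
  by apply: cvgr_dist_lt; [exact: cvg_id|rewrite divr_gt0].
move=> [z n] /= [xz anx]; rewrite -[z](subrK x) linearD.
rewrite (le_lt_trans (ler_normD _ _))// [e]splitr ltrD//.
by rewrite (le_lt_trans (aM _ _))// mulrC -ltr_pdivlMr// distrC.
Qed.

Theorem proposition2p1 (R : realType) (k : scalars)
    (X : completeNormedModType (scalar_field R k))
    (S : pred X) (Y : banachSubspaceType S)
    (Y_compact : compactly_embedded Y)
    (a : nat -> {linear X -> (scalar_field R k)^o})
    (a_continuous : forall n, continuous (a n))
    (a_null : weakly_null a) :
  exists eps : nat -> R,
    [/\ forall n, 0 <= eps n,
        nonincreasing_seq eps,
        eps @ \oo --> (0 : R) &
        forall (n : nat) (y : Y), `|a n (\val y)| <= of_real k (eps n) * `|y|].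
Proof.
have [M M0 aM] : exists2 M, 0 < M & forall n x, `|a n x| <= M * `|x|.
  apply: (uniform_boundedness (@scalar_field_archi R k) a_continuous) => x.
  have /cvg_seq_bounded/pinfty_ex_gt0[M _ axM] :
      cvgn (fun n => a n x : (scalar_field R k)^o).
    by apply/cvg_ex; exists 0; exact: a_null.
  by exists M => n; exact: axM.
move: Y_compact; rewrite /compactly_embedded /compact_operator precompactE => cC.
have unif (e : scalar_field R k) : 0 < e ->
    \forall n \near \oo, forall y : Y, `|y| <= 1 -> `|a n (\val y)| < e.
  move=> e0; have := cvg_unif_compact M0 aM (fun x _ => a_null x) cC e0.
  by apply: filterS => n h y y1; apply/h/subset_closure; exists y.
pose D n := [set r : R | exists m (y : Y),
  [/\ (n <= m)%N, `|y| <= 1 & of_real k r = `|a m (\val y)|]].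
have D0 n : D n 0.
  exists n, 0; rewrite leqnn normr0 ler01 of_real0.
  by rewrite raddf0 linear0 normr0.
(* The suprema are finite: the unit ball of [Y], being precompact, is bounded
   in [X], and [M] bounds the norms of all the functionals. *)
have [N CN] := compact_norm_lt (@scalar_field_archi R k) cC.
have valN (y : Y) : `|y| <= 1 -> `|\val y : X| <= N%:R.
  by move=> y1; apply/ltW/CN/subset_closure; exists y.
have [b bM] := normr_of_real (M * N%:R).
rewrite ger0_norm ?mulr_ge0 ?(ltW M0)// in bM.
have Db n : ubound (D n) b.
  move=> r [m [y [_ y1 ry]]]; rewrite -(of_real_le k) ry bM.
  by rewrite (le_trans (aM _ _))// ler_pM2l// valN.
have supD n : has_sup (D n) by split; [exists 0 | exists b].
exists (fun n => sup (D n)); split.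
- by move=> n; apply: ub_le_sup => //; exact: (supD n).2.
- move=> m n mn; apply: sup_le => //; last by exists 0.
  move=> r [p [y [np y1 ry]]]; apply/downP; exists r => //.
  by exists p, y; rewrite (leq_trans mn).
- apply/cvgr0Pnorm_le => e e0.
  have [|n0 _ n0P] := unif (of_real k e).
    by rewrite -(of_real0 R k) of_real_lt.
  exists n0 => // n /= n0n; rewrite ger0_norm; last first.
    by apply: ub_le_sup => //; exact: (supD n).2.
  apply: ge_sup; first by exists 0.
  move=> r [m [y [nm y1 ry]]]; rewrite -(of_real_le k) ry ltW//.
  by apply: n0P => //=; exact: leq_trans n0n nm.
- move=> n y; have [->|y0] := eqVneq y 0.
    by rewrite raddf0 linear0 !normr0 mulr0.
  have ny0 : 0 < `|y| by rewrite normr_gt0.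
  have [r rE] := normr_of_real (a n (\val (`|y|^-1 *: y))).
  have : of_real k r <= of_real k (sup (D n)).
    rewrite of_real_le; apply: ub_le_sup; first exact: (supD n).2.
    exists n, (`|y|^-1 *: y); split=> //.
    by rewrite normrZ ger0_norm ?invr_ge0// mulVf// gt_eqF.
  rewrite rE !linearZ normrZ ger0_norm ?invr_ge0//.
  by rewrite ler_pdivrMl// mulrC.
Qed.
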